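(* Let $(M,g)$ be an oriented Riemannian 4-manifold that is $*_L$-Einstein with respect to a unit length vector field $T$, and let $g_L := g-2T^\flat\otimes T^\flat$. Then for every $p\in M$ and every $P\in G_+(p)\cup G_-(p)$, $$\mathrm{sec}_{L\text{-}\hat R}(P^{\perp_L}) = \mathrm{sec}_{L\text{-}\hat R}(P).$$
   Context: Write $T^\flat := g(T,\cdot)$ and $\Lambda^2 := \Lambda^2(T_pM)$. For a metric $m$ of any signature, $\Lambda^2$ carries the inner product $\langle v_1\wedge w_1, v_2\wedge w_2\rangle_m := m(v_1,v_2)m(w_1,w_2) - m(v_1,w_2)m(w_1,v_2)$, and the Hodge star $*_m\colon\Lambda^2\to\Lambda^2$ is defined by $\xi\wedge *_m\eta = \langle\xi,\eta\rangle_m\, dV$, where $dV = e_1\wedge e_2\wedge e_3\wedge e_4$ for any oriented $m$-orthonormal basis. Here $*_L$ is the Hodge star of $g_L$ and $\langle\,,\rangle_{g_L}$ the corresponding inner product. Curvature convention: $R(a,b,c,d) := g(\nabla_a\nabla_b c-\nabla_b\nabla_a c-\nabla_{[a,b]}c,d)$; the curvature operator $\hat R_g\colon\Lambda^2\to\Lambda^2$ of $g$ is defined by $\langle\hat R_g(v\wedge w),x\wedge y\rangle_g = -R(v,w,x,y)$. $(M,g)$ is $*_L$-Einstein (with respect to the unit length vector field $T$) if $\hat R_g\circ *_L=*_L\circ\hat R_g$, where $*_L$ is the Hodge star of $g_L=g-2T^\flat\otimes T^\flat$. $G_{\pm}(p)\subseteq\Lambda^2(T_pM)$ is the set of decomposable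 2-vectors $P$ with $\langle P,P\rangle_{g_L}=\pm1$, i.e. the oriented 2-planes nondegenerate for $g_L$; $\epsilon_L(P):=\langle P,P\rangle_{g_L}=\pm1$ for $P\in G_\pm(p)$, and $P^{\perp_L}:=*_LP$. The $L$-sectional curvature of $g$ is the function $\mathrm{sec}_{L\text{-}\hat R}(P):=\epsilon_L(P)\langle\hat R_gP,P\rangle_{g_L}$ on $G_+(p)\cup G_-(p)$. *)

(* Defs.v *)
From HB Require Import structures.
From mathcomp Require Import all_boot all_order all_algebra.
From mathcomp Require Import ring.
From mathcomp Require Import all_classical all_reals all_analysis.

Set Implicit Arguments.
Unset Strict Implicit.
Unset Printing Implicit Defensive.

Import Order.TTheory GRing.Theory Num.Theory.
Import numFieldNormedType.Exports.

Local Open Scope classical_set_scope.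
Local Open Scope ring_scope.

Section smooth_maps.
Context {R : realType} {V W : normedModType R}.

(* On an open set [U] this is the usual class C^k: for k > 0, the map is
   differentiable and all its directional derivatives are C^(k-1). *)
Fixpoint Ck (k : nat) (U : set V) (f : V -> W) : Prop :=
  if k is k'.+1
  then (forall x, U x -> differentiable f x) /\
       (forall v, Ck k' U (fun x => 'd f x v))
  else forall x, U x -> {for x, continuous f}.

Definition smooth_on (U : set V) (f : V -> W) : Prop := forall k, Ck k U f.

End smooth_maps.

(* An oriented smooth 4-manifold, presented by an oriented atlas indexed by the
   points: [chart p] is a chart with domain [chart_dom p] around [p], and
   [chart_inv p] is its inverse.  The values of [chart p] outside [chart_dom p],
   and of [chart_inv p] outside the image of [chart_dom p], are irrelevant.
   Every oriented atlas contains such a family, which determines the same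
   oriented smooth structure. *)
Record oriented_manifold4 (R : realType) := OrientedManifold4 {
  carrier :> topologicalType;
  carrier_hausdorff : hausdorff_space carrier;
  carrier_second_countable : @second_countable carrier;
  chart_dom : carrier -> set carrier;
  chart : carrier -> carrier -> 'rV[R]_4;
  chart_inv : carrier -> 'rV[R]_4 -> carrier;
  chart_dom_open : forall p, open (chart_dom p);
  chart_dom_self : forall p, chart_dom p p;
  chart_img_open : forall p, open (chart p @` chart_dom p);
  chartK : forall p y, chart_dom p y -> chart_inv p (chart p y) = y;
  chart_continuous : forall p y, chart_dom p y -> {for y, continuous (chart p)};
  chart_inv_continuous : forall p x, (chart p @` chart_dom p) x ->
    {for x, continuous (chart_inv p)};
  transition_smooth : forall p q,
    smooth_on (chart p @` (chart_dom p `&` chart_dom q))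
              (chart q \o chart_inv p);
  transition_oriented : forall p q x,
    (chart p @` (chart_dom p `&` chart_dom q)) x ->
    0 < \det ('J (chart q \o chart_inv p) x)
}.

Section manifold.
Context {R : realType} (M : oriented_manifold4 R).

Definition chart_img (q : M) : set 'rV[R]_4 := chart q @` chart_dom q.

(* T_pM is identified with R^4 through [chart p]: a tangent vector at [p] is
   the row of its components in the frame of [chart p] at [p].  That frame is
   positively oriented.  A field of tangent vectors is thus a map
   [M -> 'rV[R]_4], whose value at [p] is read in [chart p]. *)

(* Change of components, from [chart p] to [chart q], of a vector tangent to M
   at [y]. *)
Definition change_chart (p q y : M) (v : 'rV[R]_4) : 'rV[R]_4 :=
  'd (chart q \o chart_inv p) (chart p y) v.

Definition local_field (X : M -> 'rV[R]_4) (q : M) (x : 'rV[R]_4) : 'rV[R]_4 :=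
  let y := chart_inv q x in change_chart y q y (X y).

Definition smooth_field (X : M -> 'rV[R]_4) : Prop :=
  forall q, smooth_on (chart_img q) (local_field X q).

Definition smooth_fun (f : M -> R) : Prop :=
  forall q, smooth_on (chart_img q) (f \o chart_inv q).

Definition derivation (X : M -> 'rV[R]_4) (f : M -> R) (p : M) : R :=
  'd (f \o chart_inv p) (chart p p) (X p).

Definition lie_bracket (X Y : M -> 'rV[R]_4) (p : M) : 'rV[R]_4 :=
  'd (local_field Y p) (chart p p) (X p)
  - 'd (local_field X p) (chart p p) (Y p).

End manifold.

(* The bilinear form on row vectors with Gram matrix [m]. *)
Definition bil {R : realType} (m : 'M[R]_4) (v w : 'rV[R]_4) : R :=
  (v *m m *m w^T) 0 0.

Definition local_metric {R : realType} (M : oriented_manifold4 R)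
    (g : M -> 'M[R]_4) (q : M) (v w : 'rV[R]_4) (x : 'rV[R]_4) : R :=
  let y := chart_inv q x in
  bil (g y) (change_chart q y y v) (change_chart q y y w).

(* [gram p] is the Gram matrix of the metric on T_pM = R^4. *)
Record riemannian_metric {R : realType} (M : oriented_manifold4 R) :=
  RiemannianMetric {
  gram :> M -> 'M[R]_4;
  gram_sym : forall p, (gram p)^T = gram p;
  gram_pos : forall p v, v != 0 -> 0 < bil (gram p) v v;
  gram_smooth : forall q v w,
    smooth_on (chart_img q) (local_metric gram q v w)
}.

(* The model of Lambda^2(R^4) as the antisymmetric 2-tensors, with
   v /\ w = v (x) w - w (x) v. *)
Record Lambda2 (R : realType) := MkLambda2 {
  tensor :> 'M[R]_4;
  tensor_anti : tensor \in [pred A : 'M[R]_4 | A^T == - A]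
}.

HB.instance Definition _ (R : realType) := [isSub for @tensor R].
HB.instance Definition _ (R : realType) := [Choice of Lambda2 R by <:].

Fact antisym_submod_closed (R : realType) :
  submod_closed [pred A : 'M[R]_4 | A^T == - A].
Proof.
split=> [|a A B]; rewrite !inE; first by rewrite trmx0 oppr0.
by move=> /eqP hA /eqP hB; rewrite linearD linearZ /= hA hB scalerN opprD.
Qed.

HB.instance Definition _ (R : realType) :=
  GRing.SubChoice_isSubLmodule.Build R 'M[R]_4 _ (Lambda2 R)
    (@antisym_submod_closed R).

Fact wedge_anti (R : realType) (v w : 'rV[R]_4) :
  v^T *m w - w^T *m v \in [pred A : 'M[R]_4 | A^T == - A].
Proof. by rewrite inE linearB /= !trmx_mul !trmxK opprB. Qed.

Definition wedge {R : realType} (v w : 'rV[R]_4) : Lambda2 R :=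
  MkLambda2 (wedge_anti v w).

(* The factor 1/2 accounts for summing over all, not only increasing, pairs of
   indices; see [inner2_wedge]. *)
Definition inner2 {R : realType} (m : 'M[R]_4) (A B : Lambda2 R) : R :=
  2^-1 * \sum_i \sum_j \sum_k \sum_l m i k * m j l * A i j * B k l.

(* The exterior product Lambda^2 x Lambda^2 -> Lambda^4, where Lambda^4(R^4) is
   identified with R by its generator d_0 /\ d_1 /\ d_2 /\ d_3 (d the canonical
   basis), so that v1 /\ v2 /\ v3 /\ v4 is the determinant of the matrix with
   rows v1, ..., v4; see [wedge22_wedge]. *)
Definition wedge22 {R : realType} (A B : Lambda2 R) : R :=
  let o k : 'I_4 := inord k in
  let a i j := (A : 'M[R]_4) (o i) (o j) in
  let b i j := (B : 'M[R]_4) (o i) (o j) in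
  a 0 1 * b 2 3 - a 0 2 * b 1 3 + a 0 3 * b 1 2
  + a 1 2 * b 0 3 - a 1 3 * b 0 2 + a 2 3 * b 0 1.

Lemma inner2_wedge (R : realType) (m : 'M[R]_4) (v1 w1 v2 w2 : 'rV[R]_4) :
  inner2 m (wedge v1 w1) (wedge v2 w2) =
  bil m v1 v2 * bil m w1 w2 - bil m v1 w2 * bil m w1 v2.
Proof.
have bilE (x y : 'rV[R]_4) : bil m x y = \sum_i \sum_k m i k * x 0 i * y 0 k.
  rewrite /bil mxE exchange_big /=; apply: eq_bigr => j _.
  by rewrite !mxE mulr_suml; apply: eq_bigr => i _; rewrite [x 0 i * _]mulrC.
have prodE (x y z t : 'rV[R]_4) : bil m x z * bil m y t =
    \sum_i \sum_j \sum_k \sum_l m i k * m j l * (x 0 i * y 0 j * z 0 k * t 0 l).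
  rewrite !bilE mulr_suml; apply: eq_bigr => i _.
  rewrite mulr_sumr; apply: eq_bigr => j _.
  rewrite mulr_suml; apply: eq_bigr => k _.
  by rewrite mulr_sumr; apply: eq_bigr => l _; ring.
suff -> : inner2 m (wedge v1 w1) (wedge v2 w2) = 2^-1 *
    (bil m v1 v2 * bil m w1 w2 - bil m v1 w2 * bil m w1 v2
     - bil m w1 v2 * bil m v1 w2 + bil m w1 w2 * bil m v1 v2) by field.
rewrite /inner2 !prodE -!sumrB -big_split; congr (_ * _).
apply: eq_bigr => i _; rewrite -!sumrB -big_split; apply: eq_bigr => j _.
rewrite -!sumrB -big_split; apply: eq_bigr => k _.
rewrite -!sumrB -big_split; apply: eq_bigr => l _.
by rewrite !mxE !big_ord1 !mxE /=; ring.
Qed.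

Lemma wedge22_wedge (R : realType) (v1 v2 v3 v4 : 'rV[R]_4) :
  wedge22 (wedge v1 v2) (wedge v3 v4) =
  \det (\matrix_(i < 4) nth 0 [:: v1; v2; v3; v4] i).
Proof.
have entryE (v : 'rV[R]_4) : {f : nat -> R | forall i j, v i j = f (val j)}.
  exists (fun k => v 0 (inord k)) => i j.
  by rewrite (ord1 i); congr (v _ _); rewrite /= inord_val.
have [f1 e1] := entryE v1; have [f2 e2] := entryE v2.
have [f3 e3] := entryE v3; have [f4 e4] := entryE v4.
rewrite /wedge22 /= !mxE !big_ord1 !mxE !(e1, e2, e3, e4) /= !inordK //.
set A := \matrix_(i < 4) _.
have AE i j : A i j = nth (fun=> 0) [:: f1; f2; f3; f4] i j.
  by rewrite mxE; case: i => [[|[|[|[|]]]]] ? //=.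
move: A AE => A AE.
do 3![rewrite !(expand_det_row _ ord0) !big_ord_recl !big_ord0 /cofactor].
rewrite !det_mx11 !mxE !AE /= /bump /=.
by ring.
Qed.

(* The rows of [E] are a positively oriented orthonormal basis of R^4 for the
   (possibly indefinite) metric [m]. *)
Definition oriented_orthonormal {R : realType} (m E : 'M[R]_4) : Prop :=
  [/\ forall i j, i != j -> bil m (row i E) (row j E) = 0,
      forall i, bil m (row i E) (row i E) = 1 \/
                bil m (row i E) (row i E) = -1 &
      0 < \det E].

(* xi /\ *eta = <xi, eta>_m dV, with dV = e_1 /\ e_2 /\ e_3 /\ e_4 = \det E. *)
Definition hodge {R : realType} (m : 'M[R]_4) (eta : Lambda2 R) : Lambda2 R :=
  xget 0 [set zeta | forall E, oriented_orthonormal m E ->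
    forall xi, wedge22 xi zeta = inner2 m xi eta * \det E].

Section curvature.
Context {R : realType} {M : oriented_manifold4 R} (g : riemannian_metric M).

Local Notation vfield := (M -> 'rV[R]_4).

Definition metric_fun (X Y : vfield) (p : M) : R := bil (g p) (X p) (Y p).

Record is_levi_civita (nabla : vfield -> vfield -> vfield) : Prop := {
  lc_smooth : forall X Y, smooth_field X -> smooth_field Y ->
    smooth_field (nabla X Y);
  lc_linear : forall f X Y Z, smooth_fun f -> smooth_field X ->
    smooth_field Y -> smooth_field Z -> forall p,
    nabla (fun q => f q *: X q + Y q) Z p = f p *: nabla X Z p + nabla Y Z p;
  lc_additive : forall X Y Z, smooth_field X -> smooth_field Y ->
    smooth_field Z -> forall p,
    nabla X (fun q => Y q + Z q) p = nabla X Y p + nabla X Z p;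
  lc_leibniz : forall f X Y, smooth_fun f -> smooth_field X ->
    smooth_field Y -> forall p,
    nabla X (fun q => f q *: Y q) p =
      derivation X f p *: Y p + f p *: nabla X Y p;
  lc_torsion_free : forall X Y, smooth_field X -> smooth_field Y -> forall p,
    nabla X Y p - nabla Y X p = lie_bracket X Y p;
  lc_metric : forall X Y Z, smooth_field X -> smooth_field Y ->
    smooth_field Z -> forall p,
    derivation X (metric_fun Y Z) p =
      metric_fun (nabla X Y) Z p + metric_fun Y (nabla X Z) p
}.

(* By the fundamental theorem of Riemannian geometry, such a connection exists
   and its values on smooth fields are determined; only those are used. *)
Definition levi_civita : vfield -> vfield -> vfield :=
  xget (fun _ _ _ => 0) [set nabla | is_levi_civita nabla].

Definition Riem (a b c d : vfield) (p : M) : R :=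
  let D := levi_civita in
  bil (g p) (D a (D b c) p - D b (D a c) p - D (lie_bracket a b) c p) (d p).

(* Tangent vectors at [p] are given as the values at [p] of smooth fields;
   [Riem a b c d p] depends only on these values. *)
Definition is_curvature_operator (p : M) (Q : Lambda2 R -> Lambda2 R) : Prop :=
  linear Q /\
  forall a b c d : vfield, smooth_field a -> smooth_field b ->
    smooth_field c -> smooth_field d ->
    inner2 (g p) (Q (wedge (a p) (b p))) (wedge (c p) (d p))
    = - Riem a b c d p.

Definition curvature_operator (p : M) : Lambda2 R -> Lambda2 R :=
  xget (fun _ => 0) [set Q | is_curvature_operator p Q].

Section lorentz.
Variable T : vfield.

Definition unit_field : Prop :=
  smooth_field T /\ forall p, bil (g p) (T p) (T p) = 1.

Definition flat (p : M) : 'rV[R]_4 := T p *m g p.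

Definition gL (p : M) : 'M[R]_4 := g p - 2 *: ((flat p)^T *m flat p).

Definition starL (p : M) : Lambda2 R -> Lambda2 R := hodge (gL p).

Definition starL_einstein : Prop := forall p,
  curvature_operator p \o starL p = starL p \o curvature_operator p.

Definition decomposable (P : Lambda2 R) : Prop := exists v w, P = wedge v w.

Definition Gplus (p : M) : set (Lambda2 R) :=
  [set P | decomposable P /\ inner2 (gL p) P P = 1].

Definition Gminus (p : M) : set (Lambda2 R) :=
  [set P | decomposable P /\ inner2 (gL p) P P = -1].

Definition epsL (p : M) (P : Lambda2 R) : R := inner2 (gL p) P P.

(* Meaningful on [Gplus p `|` Gminus p]. *)
Definition secL (p : M) (P : Lambda2 R) : R :=
  epsL p P * inner2 (gL p) (curvature_operator p P) P.

End lorentz.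
End curvature.

(* Main.v *)
Require Import Defs.
From mathcomp Require Import all_boot all_order all_algebra.
From mathcomp Require Import perm ring lra.
From mathcomp Require Import all_classical all_reals all_analysis.
Import Order.TTheory GRing.Theory Num.Theory.
Local Open Scope classical_set_scope.
Local Open Scope ring_scope.

(** The theorem is pointwise linear algebra.  In Lorentzian signature the Hodge
star [S] is an anti-isometry of the exterior square ([inner2_hodge], with the
factor [-1] of [lorentz_frame]): [<S A, S B> = - <A, B>].  Hence [epsL] changes
sign under [P |-> S P], and, since the curvature operator [Q] commutes with
[S], so does the other factor of [secL]:
[<Q S P, S P> = <S Q P, S P> = - <Q P, P>].  Their product is unchanged.  The
2-vector [S P] is again decomposable, because a 2-vector is decomposable
exactly when its exterior square vanishes ([wedge22_decomposable]), and
[S P /\ S P] is a multiple of [P /\ P].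

The work lies in making the star computable, as [hodge] only gives a solution
of its characteristic equation, if there is one.  For an oriented orthonormal
frame [E] of [m], [hodgeE] gives the solution
[S A = det E . estar (m A m^T)]: first lower the indices of [A] with [m], then
apply the Euclidean star [estar].  It does not depend on the frame since
[(det E)^2 |det m| = 1] ([frame_det]).  As [estar] is an isometric involution
and lowering indices multiplies the exterior pairing by [det m]
([wedge22_ext2]), it follows that [S S = (det E)^2 (det m)]
([hodgeK]), which is [-1] in Lorentzian signature, and this gives the
anti-isometry.  A frame exists by Gram-Schmidt: a [g]-orthonormal basis that
contains [T] is also orthonormal for [g - 2 T^flat (x) T^flat]. *)

(** * The exterior square *)

Section ExteriorSquare.
Context {R : realType}.
Implicit Types (m E : 'M[R]_4) (A B C : Lambda2 R) (v w : 'rV[R]_4).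

Lemma antisymE A (i j : 'I_4) : tensor A i j = - tensor A j i.
Proof.
have := tensor_anti A; rewrite inE => /eqP /matrixP /(_ j i).
by rewrite !mxE.
Qed.

Lemma antisym_diag A (i : 'I_4) : tensor A i i = 0.
Proof. have := antisymE A i i; lra. Qed.

(** Indexing by [nat] lets a computation on all the entries reduce to literal
indices, where antisymmetry can be used to normalize them. *)
Lemma antisym_entries A : {a : nat -> nat -> R |
  [/\ forall i j, tensor A i j = a (val i) (val j),
      forall k, a k k = 0 & forall k l, a k l = - a l k]}.
Proof.
exists (fun k l => tensor A (inord k) (inord l)).
split=> [i j|k|k l]; first by rewrite !inord_val.
  exact: antisym_diag.
exact: antisymE.
Qed.

Lemma Lambda2_eq A B : (forall i j, tensor A i j = tensor B i j) -> A = B.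
Proof. by move=> AB; apply: val_inj; apply/matrixP. Qed.

Lemma tensor_linear a A B : tensor (a *: A + B) = a *: tensor A + tensor B.
Proof. exact: (linearP val). Qed.

Lemma tensor_linE a A B (i j : 'I_4) :
  (a *: A + B : Lambda2 R) i j = a * tensor A i j + tensor B i j.
Proof. by rewrite tensor_linear !mxE. Qed.

Lemma wedgeE v w (i j : 'I_4) :
  wedge v w i j = v 0 i * w 0 j - w 0 i * v 0 j.
Proof. by rewrite /= !mxE !big_ord1 !mxE. Qed.

(** The wedges span, by the expansion [A = 1/2 sum_i e_i /\ (row i A)]; so
(bi)linear identities need only be checked on wedges. *)
Lemma wedge_ind (K : Lambda2 R -> Prop) :
    (forall a A B, K A -> K B -> K (a *: A + B)) ->
    (forall v w, K (wedge v w)) ->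
  forall A, K A.
Proof.
move=> Klin Kwedge A.
have K0 : K 0.
  by have := Klin (-1) _ _ (Kwedge 0 0) (Kwedge 0 0); rewrite scaleN1r addNr.
have -> : A = 2^-1 *: (\sum_(i < 4) wedge (delta_mx 0 i) (row i A)) + 0.
  apply: Lambda2_eq => i j; rewrite tensor_linE.
  have -> : tensor (\sum_(k < 4) wedge (delta_mx 0 k) (row k A)) =
      \sum_(k < 4) tensor (wedge (delta_mx 0 k) (row k A)).
    exact: (raddf_sum (val : Lambda2 R -> 'M[R]_4)).
  rewrite summxE (eq_bigr (fun k : 'I_4 =>
    (k == i)%:R * tensor A i j - (k == j)%:R * tensor A j i)); last first.
    move=> k _; rewrite wedgeE !mxE eqxx /= ![_ == k]eq_sym.
    by case: (k =P i) => [<-|_]; case: (k =P j) => [<-|_] /=; ring.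
  have sum_delta (x : 'I_4) (y : R) : \sum_(k < 4) (k == x)%:R * y = y.
    rewrite (bigD1 x) //= eqxx mul1r big1 ?addr0 // => k /negbTE ->.
    by rewrite mul0r.
  rewrite sumrB !sum_delta (antisymE A j i).
  have -> : (0 : Lambda2 R) i j = 0.
    by rewrite (_ : tensor 0 = 0) ?mxE //; exact: (raddf0 val).
  by field.
apply: (Klin) => //.
elim/big_ind: _ => // B C KB KC.
by rewrite -[B]scale1r; apply: Klin.
Qed.

Lemma wedge22C A B : wedge22 A B = wedge22 B A.
Proof. by rewrite /wedge22; ring. Qed.

Lemma wedge22_linl a A B C :
  wedge22 (a *: A + B) C = a * wedge22 A C + wedge22 B C.
Proof. by rewrite /wedge22 !tensor_linE; ring. Qed.

Lemma inner2_linl m a A B C :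
  inner2 m (a *: A + B) C = a * inner2 m A C + inner2 m B C.
Proof.
rewrite /inner2 mulrCA -mulrDr; congr (_ * _).
do 4![rewrite mulr_sumr -big_split; apply: eq_bigr => ? _].
by rewrite tensor_linE /=; ring.
Qed.

Lemma inner2_linr m a A B C :
  inner2 m C (a *: A + B) = a * inner2 m C A + inner2 m C B.
Proof.
rewrite /inner2 mulrCA -mulrDr; congr (_ * _).
do 4![rewrite mulr_sumr -big_split; apply: eq_bigr => ? _].
by rewrite tensor_linE /=; ring.
Qed.

Lemma bilC m v w : m^T = m -> bil m v w = bil m w v.
Proof.
move=> msym; rewrite /bil; have <- : (w *m m *m v^T)^T = v *m m *m w^T.
  by rewrite !trmx_mul trmxK msym mulmxA.
by rewrite mxE.
Qed.

Lemma inner2C m A B : m^T = m -> inner2 m A B = inner2 m B A.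
Proof.
move=> msym; elim/wedge_ind: A => [a A A' IH IH'|v w].
  by rewrite inner2_linl inner2_linr IH IH'.
elim/wedge_ind: B => [a B B' IH IH'|v' w'].
  by rewrite inner2_linl inner2_linr IH IH'.
by rewrite !inner2_wedge !(bilC m v') // !(bilC m w') //; ring.
Qed.

(** * The Euclidean star and the lowering of indices *)

Fact ext2_anti m A : m *m A *m m^T \in [pred A : 'M[R]_4 | A^T == - A].
Proof.
rewrite inE !trmx_mul trmxK; have /eqP -> := tensor_anti A.
by rewrite mulNmx mulmxN mulmxA.
Qed.

(** The map induced by [m] on the exterior square, by [ext2_wedge]; when [m] is
a metric, it lowers both indices of [A]. *)
Definition ext2 m A : Lambda2 R := MkLambda2 (ext2_anti m A).

Lemma ext2_wedge m v w : ext2 m (wedge v w) = wedge (v *m m^T) (w *m m^T).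
Proof.
by apply: val_inj; rewrite /= mulmxBr mulmxBl !trmx_mul !trmxK !mulmxA.
Qed.

Lemma ext2_lin m a A B : ext2 m (a *: A + B) = a *: ext2 m A + ext2 m B.
Proof.
apply: val_inj; rewrite -![\val _]/(tensor _) tensor_linear.
rewrite -![tensor (ext2 _ _)]/(_ *m _ *m _) tensor_linear.
by rewrite mulmxDr mulmxDl -scalemxAr -scalemxAl.
Qed.

(** The induced map on the fourth exterior power is multiplication by the
determinant. *)
Lemma wedge22_ext2 m A B :
  wedge22 (ext2 m A) (ext2 m B) = \det m * wedge22 A B.
Proof.
elim/wedge_ind: A => [a A A' IH IH'|v1 v2].
  by rewrite ext2_lin !wedge22_linl IH IH'; ring.
rewrite wedge22C [wedge22 (wedge _ _) B]wedge22C.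
elim/wedge_ind: B => [a B B' IH IH'|v3 v4].
  by rewrite ext2_lin !wedge22_linl IH IH'; ring.
rewrite !ext2_wedge !wedge22_wedge -[\det m]det_tr mulrC -det_mulmx.
congr (\det _); apply/row_matrixP => i; rewrite row_mul !rowK.
by case: i => [[|[|[|[|]]]]].
Qed.

(** This reduces every metric to the Euclidean one. *)
Lemma inner2_ext2 m A B : inner2 m A B = inner2 1%:M A (ext2 m B).
Proof.
elim/wedge_ind: A => [a A A' IH IH'|v w]; first by rewrite !inner2_linl IH IH'.
elim/wedge_ind: B => [a B B' IH IH'|v' w'].
  by rewrite ext2_lin !inner2_linr IH IH'.
have bil1 x y : bil 1%:M x (y *m m^T) = bil m x y.
  by rewrite /bil mulmx1 trmx_mul trmxK mulmxA.
by rewrite ext2_wedge !inner2_wedge !bil1.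
Qed.

Fact estar_anti A :
  \matrix_(i, j) wedge22 (wedge (delta_mx 0 i) (delta_mx 0 j)) A
    \in [pred A : 'M[R]_4 | A^T == - A].
Proof.
rewrite inE; apply/eqP/matrixP => i j; rewrite !mxE.
by rewrite /wedge22 !wedgeE; ring.
Qed.

(** The Euclidean Hodge star, of entries [1/2 sum_kl eps_ijkl A_kl]: the
pairings of [A] with the basis [e_i /\ e_j]. *)
Definition estar A : Lambda2 R := MkLambda2 (estar_anti A).

Lemma estarE A i j :
  tensor (estar A) i j = wedge22 (wedge (delta_mx 0 i) (delta_mx 0 j)) A.
Proof. by rewrite mxE. Qed.

Lemma inner2_1E A B :
  inner2 1%:M A B =
    2^-1 * \sum_(i < 4) \sum_(j < 4) tensor A i j * tensor B i j.
Proof.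
rewrite /inner2; congr (_ * _); apply: eq_bigr => i _; apply: eq_bigr => j _.
rewrite (bigD1 i) //= (bigD1 j) //= !big1 ?addr0 ?mxE ?eqxx ?mul1r //.
  by move=> k /negbTE ki; apply: big1 => l _; rewrite !mxE eq_sym ki !mul0r.
by move=> l /negbTE lj; rewrite !mxE [j == l]eq_sym lj mulr0 !mul0r.
Qed.

Lemma wedge22_estar A B : wedge22 A (estar B) = inner2 1%:M A B.
Proof.
rewrite inner2_1E.
have [a [aE a0 aN]] := antisym_entries A.
have [b [bE b0 bN]] := antisym_entries B.
(* Both sides become the sum of [a i j * b i j] over [i < j]. *)
rewrite !big_ord_recl !big_ord0 !aE !bE /= /bump /= ?add1n ?add0n.
rewrite !a0 (aN 1 0) (aN 2 0) (aN 3 0) (aN 2 1) (aN 3 1) (aN 3 2)%N.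
rewrite (bN 1 0) (bN 2 0) (bN 3 0) (bN 2 1) (bN 3 1) (bN 3 2)%N.
(* Expanding with general [v], [w] before they become basis vectors keeps the
   terms small. *)
have wedgeB v w : wedge22 (wedge v w) B =
    let x k l :=
      v 0 (inord k) * w 0 (inord l) - w 0 (inord k) * v 0 (inord l) in
    (x 0 1 * b 2 3 - x 0 2 * b 1 3 + x 0 3 * b 1 2
    + x 1 2 * b 0 3 - x 1 3 * b 0 2 + x 2 3 * b 0 1).
  by rewrite /wedge22 !wedgeE !bE /= !inordK.
rewrite /wedge22 !estarE !aE !wedgeB /= !mxE.
rewrite -!val_eqE /= !inordK //=.
by field.
Qed.

Lemma inner2_delta A (i j : 'I_4) :
  inner2 1%:M (wedge (delta_mx 0 i) (delta_mx 0 j)) A = tensor A i j.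
Proof.
elim/wedge_ind: A => [a A B IHA IHB|v w].
  by rewrite inner2_linr IHA IHB tensor_linE.
have bil1 k x : bil 1%:M (delta_mx 0 k) x = x 0 k.
  by rewrite /bil mulmx1 -rowE !mxE.
by rewrite inner2_wedge !bil1 wedgeE; ring.
Qed.

(** [wedge22_estar] at [e_i /\ e_j] reads off the entries of both sides. *)
Lemma estarK A : estar (estar A) = A.
Proof.
by apply: Lambda2_eq => i j; rewrite estarE wedge22_estar inner2_delta.
Qed.

(** The exterior pairing is nondegenerate, so that the characteristic equation
of the Hodge star has at most one solution. *)
Lemma wedge22_inj A B : (forall C, wedge22 C A = wedge22 C B) -> A = B.
Proof.
move=> AB; rewrite -[A]estarK -[B]estarK; congr estar.
by apply: Lambda2_eq => i j; rewrite !estarE AB.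
Qed.

(** * Decomposable 2-vectors *)

(** The difference of the two sides is alternating in the four indices, and is
the Pfaffian of [A], that is half of [wedge22 A A], at the indices
[0, 1, 2, 3]. *)
Lemma plucker A (i j k l : 'I_4) : wedge22 A A = 0 ->
  tensor A i j * tensor A k l =
  tensor A i k * tensor A j l - tensor A j k * tensor A i l.
Proof.
have [a [aE a0 aN]] := antisym_entries A.
rewrite /wedge22 !aE /= !inordK // => Pf.
(* Each side changes sign when [i], [j] or [k], [l] are exchanged. *)
wlog ij : i j / (i < j)%N => [sorted|].
  have [/sorted //|/sorted|ij] := ltngtP i j.
    by rewrite (aN j i); lra.
  by rewrite ij a0; ring.
wlog kl : k l / (k < l)%N => [sorted|].
  have [/sorted //|/sorted|kl] := ltngtP k l.
    by rewrite (aN l k); lra.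
  by rewrite kl a0; ring.
case: i ij => [[|[|[|[|]]]]] //= _; case: j => [[|[|[|[|]]]]] //= _ _;
case: k kl => [[|[|[|[|]]]]] //= _; case: l => [[|[|[|[|]]]]] //= _ _;
  rewrite ?a0 ?(aN 1 0)%N ?(aN 2 0)%N ?(aN 3 0)%N ?(aN 2 1)%N ?(aN 3 1)%N
    ?(aN 3 2)%N; lra.
Qed.

(** If [A] has an entry [A i j != 0], then [plucker] says that
[A = (A i j)^-1 (row i A) /\ (row j A)]. *)
Lemma wedge22_decomposable A : wedge22 A A = 0 <-> decomposable A.
Proof.
split=> [AA0|[v [w ->]]]; last first.
  (* In [v /\ w /\ v /\ w], the vectors 0 and 2 agree. *)
  rewrite wedge22_wedge.
  apply: (determinant_alternate (i1 := inord 0) (i2 := inord 2)).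
    by rewrite -val_eqE /= !inordK.
  by move=> j; rewrite !mxE !inordK.
have [A0|] := pselect (forall i j, tensor A i j = 0).
  by exists 0, 0; apply: Lambda2_eq => i j; rewrite A0 wedgeE !mxE; ring.
move=> /existsNP[i /existsNP[j /eqP Aij]].
exists ((tensor A i j)^-1 *: row i A), (row j A).
apply: Lambda2_eq => k l; rewrite wedgeE !mxE.
apply: (mulfI Aij); rewrite plucker //.
by field.
Qed.

Lemma wedge22Zl a A B : wedge22 (a *: A) B = a * wedge22 A B.
Proof.
have wedge0 : wedge22 0 B = 0.
  by rewrite -(addNr B) -scaleN1r wedge22_linl mulN1r addNr.
by rewrite -[a *: A]addr0 wedge22_linl wedge0 addr0.
Qed.

Lemma wedge22Zr a A B : wedge22 B (a *: A) = a * wedge22 B A.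
Proof. by rewrite wedge22C wedge22Zl wedge22C. Qed.

(** * The Hodge star of a metric of any signature *)

Lemma frame_gramE m E i j : bil m (row i E) (row j E) = (E *m m *m E^T) i j.
Proof.
by rewrite /bil -!row_mul !mxE; apply: eq_bigr => k _; rewrite !mxE.
Qed.

(** The Gram matrix [E m E^T] of the frame is diagonal with entries [1] or
[-1].  As [det E] is positive, it is thus the same for all frames. *)
Lemma frame_det m E : oriented_orthonormal m E ->
  \det E ^+ 2 * `|\det m| = 1.
Proof.
move=> [orth norm1 pos].
have diagE : E *m m *m E^T = diag_mx (\row_i (E *m m *m E^T) i i).
  apply/matrixP => i j; rewrite -frame_gramE mxE mxE -frame_gramE.
  by case: eqVneq => [->|ij]; rewrite ?mulr1n // mulr0n orth.
have := congr1 (fun x => `|\det x|) diagE.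
rewrite !det_mulmx det_tr det_diag normr_prod big1 => [|i _]; last first.
  by rewrite mxE -frame_gramE; case: (norm1 i) => ->; rewrite ?normrN normr1.
by rewrite !normrM (gtr0_norm pos) => <-; ring.
Qed.

(** The right-hand side solves the characteristic equation of the star for
every frame, and the frame [E] makes the solution unique. *)
Lemma hodgeE m E A : oriented_orthonormal m E ->
  hodge m A = \det E *: estar (ext2 m A).
Proof.
move=> ooE; have [_ _ detE] := ooE.
rewrite /hodge; set S := [set zeta | _].
have Sstar : S (\det E *: estar (ext2 m A)).
  move=> F ooF C; rewrite wedge22Zr wedge22_estar -inner2_ext2 mulrC.
  congr (_ * _).
  (* The two frames have the same determinant. *)
  have [_ _ detF] := ooF.
  apply: (pexpIrn (n := 2)); rewrite ?nnegrE ?ltW //.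
  have := frame_det _ _ ooE; have := frame_det _ _ ooF => F1 E1.
  have m0 : `|\det m| != 0.
    by apply/eqP => m0; move/eqP: E1; rewrite m0 mulr0 eq_sym oner_eq0.
  by apply: (mulIf m0); rewrite E1 F1.
have Sx : S (xget 0 S) by apply: xgetPex; exists (\det E *: estar (ext2 m A)).
by apply: wedge22_inj => C; rewrite (Sx E ooE) (Sstar E ooE).
Qed.

Lemma wedge22_hodge m E A B : oriented_orthonormal m E ->
  wedge22 A (hodge m B) = inner2 m A B * \det E.
Proof.
by move=> /hodgeE ->; rewrite wedge22Zr wedge22_estar -inner2_ext2 mulrC.
Qed.

(** Put [c = det E], let [L] lower indices and let [S] be the star, so that
[S A = c estar (L A)].  For every [C],
[C /\ S S A = c <C, S A> = c <S A, C> = c (S A /\ estar (L C))].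
Since [estar] is an isometric involution, this is [c^2 (L C /\ L A)], that is
[c^2 (det m) (C /\ A)]. *)
Lemma hodgeK m E A : m^T = m -> oriented_orthonormal m E ->
  hodge m (hodge m A) = (\det E ^+ 2 * \det m) *: A.
Proof.
move=> msym ooE; apply: wedge22_inj => C.
rewrite (wedge22_hodge _ E) // inner2C // inner2_ext2 -wedge22_estar.
rewrite (hodgeE _ E) // wedge22Zl wedge22_estar inner2C ?trmx1 //.
rewrite -wedge22_estar estarK wedge22_ext2 wedge22Zr.
by ring.
Qed.

(** With [S] for the star, [det E <S A, S B> = S A /\ S S B], and [S S] is the
scalar of [hodgeK], while [S A /\ B = B /\ S A = det E <B, A>]. *)
Lemma inner2_hodge m E A B : m^T = m -> oriented_orthonormal m E ->
  inner2 m (hodge m A) (hodge m B) = \det E ^+ 2 * \det m * inner2 m A B.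
Proof.
move=> msym ooE; have [_ _ detE] := ooE.
have detE0 : \det E != 0 by rewrite gt_eqF.
apply: (mulIf detE0); rewrite -(wedge22_hodge _ E) // (hodgeK _ E) // wedge22Zr.
by rewrite wedge22C (wedge22_hodge _ E) // [inner2 m B A]inner2C // mulrA.
Qed.

(** With [S] for the star,
[S A /\ S A = det E <S A, A> = det E <A, S A> = A /\ S S A], a multiple of
[A /\ A]. *)
Lemma decomposable_hodge m E A : m^T = m -> oriented_orthonormal m E ->
  decomposable A -> decomposable (hodge m A).
Proof.
move=> msym ooE /wedge22_decomposable AA0; apply/wedge22_decomposable.
rewrite (wedge22_hodge _ E) // inner2C // -(wedge22_hodge _ E) //.
by rewrite (hodgeK _ E) // wedge22Zr AA0 mulr0.
Qed.

End ExteriorSquare.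

(** * Lorentzian frames *)

Section LorentzFrame.
Context {R : realType}.
Implicit Types (g : 'M[R]_4) (t : 'rV[R]_4).

(** Gram-Schmidt, started at [t]: as long as there are fewer than four vectors
some nonzero vector is orthogonal to all of them. *)
Lemma orthonormal_family g t k : g^T = g ->
    (forall v, v != 0 -> 0 < bil g v v) -> bil g t t = 1 -> (k < 4)%N ->
  exists V : 'M[R]_(k.+1, 4), V *m g *m V^T = 1%:M /\ exists i, row i V = t.
Proof.
move=> g_sym g_pos t_unit; elim: k => [_|k IH lek4].
  exists t; split; last by exists 0; apply/rowP => j; rewrite mxE.
  by apply/matrixP => i j; rewrite !ord1 -[LHS]/(bil g t t) t_unit !mxE.
have [V [gramV [i0 Vi0]]] := IH (ltnW lek4).
(* [u *m (g *m V^T) = 0] says that [u] is orthogonal to the rows of [V]. *)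
have ker_neq0 : kermx (g *m V^T) != 0.
  rewrite -mxrank_eq0 mxrank_ker -lt0n subn_gt0.
  exact: leq_ltn_trans (rank_leq_col _) lek4.
have /rowV0Pn[u /sub_kermxP uV u0] := ker_neq0.
pose c := Num.sqrt (bil g u u).
have c0 : c != 0 by rewrite gt_eqF // sqrtr_gt0 g_pos.
pose e : 'rV[R]_4 := c^-1 *: u.
have eV : e *m g *m V^T = 0 by rewrite -mulmxA -scalemxAl uV scaler0.
have Ve : V *m g *m e^T = 0.
  by apply: trmx_inj; rewrite !trmx_mul trmxK g_sym mulmxA eV trmx0.
have ee : e *m g *m e^T = 1%:M.
  have bilZ : bil g e e = c^-1 * (c^-1 * bil g u u).
    by rewrite /bil /e linearZ /= -scalemxAr -!scalemxAl mxE mxE.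
  rewrite [LHS]mx11_scalar -/(bil g e e) bilZ.
  by rewrite -(sqr_sqrtr (ltW (g_pos u u0))) -/c; congr (_%:M); field.
have gramW : col_mx e V *m g *m (col_mx e V)^T = 1%:M.
  by rewrite mul_col_mx tr_col_mx mul_col_row ee eV Ve gramV -scalar_mx_block.
exists (col_mx e V); split; first exact: gramW.
exists (rshift 1 i0); rewrite -Vi0; apply/rowP => j; rewrite mxE [RHS]mxE.
exact: (col_mxEd e V i0 j).
Qed.

(** [t *m g] is the covector of [t], so this is [gL] at a point. *)
Definition lorentz g t : 'M[R]_4 := g - 2 *: ((t *m g)^T *m (t *m g)).

Lemma lorentz_sym g t : g^T = g -> (lorentz g t)^T = lorentz g t.
Proof.
by move=> g_sym; rewrite /lorentz linearB linearZ /= g_sym trmx_mul trmxK.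
Qed.

(** A [g]-orthonormal basis containing [t] is orthonormal for [lorentz g t],
where [t] has square [-1] and the other vectors keep the square [1]; exchanging
two of its vectors, if necessary, makes it oriented. *)
Lemma lorentz_frame g t : g^T = g ->
    (forall v, v != 0 -> 0 < bil g v v) -> bil g t t = 1 ->
  exists2 E, oriented_orthonormal (lorentz g t) E &
    \det E ^+ 2 * \det (lorentz g t) = -1.
Proof.
move=> g_sym g_pos t_unit; set m := lorentz g t.
have [V [gramV [i0 Vi0]]] := orthonormal_family g t 3 g_sym g_pos t_unit isT.
pose d : 'rV[R]_4 := \row_i (if i == i0 then -1 else 1).
have gramV_m : V *m m *m V^T = diag_mx d.
  have tV : t *m g *m V^T = delta_mx 0 i0.
    by rewrite -Vi0 -!row_mul gramV rowE mulmx1.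
  have Vt : V *m (t *m g)^T = delta_mx i0 0.
    by apply: trmx_inj; rewrite trmx_mul trmxK tV trmx_delta.
  rewrite /m /lorentz mulmxBr mulmxBl gramV -scalemxAr -scalemxAl (mulmxA V) Vt.
  rewrite -(mulmxA _ (t *m g)) tV.
  rewrite mul_delta_mx; apply/matrixP => i j; rewrite !mxE.
  case: (eqVneq i j) => [<-|ij]; case: (eqVneq i i0) => [ii|_] //=;
    rewrite ?mulr1n ?mulr0n /=.
  - by ring.
  - by ring.
  - by rewrite -ii [j == i]eq_sym (negbTE ij) /=; ring.
  by ring.
have detV : \det V ^+ 2 * \det m = -1.
  have <- : \det (diag_mx d) = -1.
    rewrite det_diag (bigD1 i0) //= mxE eqxx big1 ?mulr1 // => i /negbTE ii.
    by rewrite mxE ii.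
  by rewrite -gramV_m !det_mulmx det_tr; ring.
have orthV (s : 'S_4) (i j : 'I_4) :
    bil m (row i (row_perm s V)) (row j (row_perm s V)) = d 0 (s i) *+ (i == j).
  have rowE k : row k (row_perm s V) = row (s k) V.
    by apply/rowP => l; rewrite !mxE.
  by rewrite !rowE frame_gramE gramV_m mxE (inj_eq perm_inj).
have ooV s : 0 < \det (row_perm s V) -> oriented_orthonormal m (row_perm s V).
  split=> // [i j /negbTE ij|i]; rewrite orthV ?ij ?mulr0n // eqxx mulr1n mxE.
  by case: ifP; [right|left].
have [detV0|detV0|detV0] := ltgtP 0 (\det V).
- exists (row_perm 1 V); first by apply: ooV; rewrite row_perm1.
  by rewrite row_perm1.
- pose s : 'S_4 := tperm 0 1.
  have dets : \det (row_perm s V) = - \det V.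
    by rewrite row_permE det_mulmx det_perm odd_tperm expr1 mulN1r.
  exists (row_perm s V); first by apply: ooV; rewrite dets oppr_gt0.
  by rewrite dets sqrrN.
by move/eqP: detV; rewrite -detV0 expr0n mul0r eq_sym oppr_eq0 oner_eq0.
Qed.

End LorentzFrame.

(** * The L-sectional curvature *)

Theorem theorem2 (R : realType) (M : oriented_manifold4 R)
    (g : riemannian_metric M) (T : M -> 'rV[R]_4)
    (hT : unit_field g T) (hE : starL_einstein g T)
    (p : M) (P : Lambda2 R) (hP : (Gplus g T p `|` Gminus g T p) P) :
  (Gplus g T p `|` Gminus g T p) (starL g T p P) /\
  secL g T p (starL g T p P) = secL g T p P.
Proof.
have gL_sym : (gL g T p)^T = gL g T p := lorentz_sym _ _ (gram_sym g p).
have [E ooE detE] : exists2 E, oriented_orthonormal (gL g T p) E &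
    \det E ^+ 2 * \det (gL g T p) = -1 :=
  lorentz_frame _ _ (gram_sym g p) (gram_pos g p) (hT.2 p).
have starL_anti A B : inner2 (gL g T p) (starL g T p A) (starL g T p B) =
    - inner2 (gL g T p) A B.
  by rewrite (inner2_hodge _ E) // detE mulN1r.
split.
  (* The star exchanges [Gplus] and [Gminus]. *)
  have star_dec : decomposable P -> decomposable (starL g T p P).
    exact: (decomposable_hodge _ E).
  case: hP => -[/star_dec decP normP]; [right|left];
    by split=> //; rewrite starL_anti normP ?opprK.
have comm : curvature_operator g p (starL g T p P) =
    starL g T p (curvature_operator g p P) := congr1 (@^~ P) (hE p).
by rewrite /secL /epsL comm !starL_anti mulrNN.
Qed.
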